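(* Let $\mathcal{H}$ be a real Hilbert space, let $A\colon\mathcal{H}\rightrightarrows\mathcal{H}$ be maximally monotone and strongly monotone with modulus $\gamma_A\ge 0$, and let $B\colon\mathcal{H}\to\mathcal{H}$ be single-valued, $\beta$-co-coercive with $\beta>0$, and strongly monotone with modulus $\gamma_B\geq 0$ (the values $\gamma_A=0$, $\gamma_B=0$ are allowed). Suppose $\mathrm{zer}(A+B)\neq\emptyset$. Let $\sigma\in(0,+\infty)$ and let $(M_k)_{k\in\mathbb{N}}$ be a sequence in $\mathcal{S}_\sigma(\mathcal{H})$ such that $C:=\sup_{k\in\mathbb{N}}\|M_k\|<\infty$, there exists $(\eta_k)_{k\in\mathbb{N}}\in\ell^1_+(\mathbb{N})$ with $(1+\eta_k)M_k\succeq M_{k+1}$ for all $k\in\mathbb{N}$, and, for some $\kappa>0$, $M_k-\frac{1}{2\beta}\mathrm{Id}\in\mathcal{S}_\kappa(\mathcal{H})$ for all $k\in\mathbb{N}$. Let $z_{-1},z_0\in\mathcal{H}$ and let $(z_k)_{k\in\mathbb{N}}$ be generated, for $k=0,1,2,\dots$, by $$\bar z_k=z_k+\alpha_k(z_k-z_{k-1}),\qquad z_{k+1}=J_A^{M_k}\big(\bar z_k-M_k^{-1}B\bar z_k\big)+\epsilon_k ,$$ where $(\alpha_k)_{k\in\mathbb{N}}$ satisfies $\alpha_k\in(0,\Lambda]$ with $\Lambda<\infty$ and $$\sum_{k\in\mathbb{N}}\alpha_k\max\{\|z_k-z_{k-1}\|_{M_k},\|z_k-z_{k-1}\|_{M_k}^2\}<+\infty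 ,$$ and $(\epsilon_k)_{k\in\mathbb{N}}$ is a sequence in $\mathcal{H}$ with $\sum_{k\in\mathbb{N}}\|\epsilon_k\|<+\infty$. Then $(z_k)_{k\in\mathbb{N}}$ is bounded and converges weakly to a point $z^*\in\mathrm{zer}(A+B)$. Furthermore, if additionally $\epsilon_k=0$ for all $k\in\mathbb{N}$, $\gamma_A>0$ or $\gamma_B>0$, and, for some $\kappa>0$, $M_k-\frac1\beta\mathrm{Id}\in\mathcal{S}_\kappa(\mathcal{H})$ for all $k\in\mathbb{N}$, then there exist $\xi\in(0,1)$, $\Theta>0$ and $K_0\in\mathbb{N}$ such that for every $k>K_0$, $$\|z_k-z^*\|_{M_k}^2\le(1-\xi)^{k-K_0}\|z_{K_0}-z^*\|_{M_{K_0}}^2+\sum_{i=K_0}^{k-1}\Theta(1-\xi)^{k-i}\alpha_i\max\{\|z_i-z_{i-1}\|_{M_i},\|z_i-z_{i-1}\|_{M_i}^2\}.$$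
   Context: $\mathcal{S}(\mathcal{H})$ is the set of bounded self-adjoint linear operators on $\mathcal{H}$; $U\succeq V$ means $\langle Ux,x\rangle\ge\langle Vx,x\rangle$ for all $x\in\mathcal{H}$; for $\sigma\ge0$, $\mathcal{S}_\sigma(\mathcal{H})=\{U\in\mathcal{S}(\mathcal{H}): U\succeq\sigma\,\mathrm{Id}\}$. $\|M\|$ is the operator norm and $\|x\|_M=\sqrt{\langle Mx,x\rangle}$. $\ell^1_+(\mathbb{N})$ is the set of summable sequences in $[0,+\infty)$. $\mathrm{zer}(A+B)=\{x: 0\in Ax+Bx\}$. An operator $A$ is strongly monotone with modulus $\gamma\ge0$ if $\langle x-y,u-v\rangle\ge\gamma\|x-y\|^2$ for all $u\in Ax$, $v\in Ay$ ($\gamma=0$ is ordinary monotonicity). $B$ is $\beta$-co-coercive if $\langle x-y,Bx-By\rangle\ge\beta\|Bx-By\|^2$ for all $x,y$. The resolvent of $A$ in the metric $M$ is $J_A^M=(\mathrm{Id}+M^{-1}A)^{-1}$. *)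

(* Defs.v *)
From HB Require Import structures.
From mathcomp Require Import all_boot all_order all_algebra.
From mathcomp Require Import all_classical all_reals all_analysis.

Set Implicit Arguments.
Unset Strict Implicit.
Unset Printing Implicit Defensive.

Import Order.TTheory GRing.Theory Num.Theory.
Import numFieldNormedType.Exports.

Local Open Scope classical_set_scope.
Local Open Scope ring_scope.

(* Real Hilbert spaces: Banach spaces whose norm comes from an inner product. *)
HB.mixin Record CompleteNormedModule_isHilbert (R : realType) H
    of CompleteNormedModule R H := {
  inner : {dot H for @idfun R} ;
  norm_inner : forall x : H, `|x| = Num.sqrt (inner x x)
}.

#[short(type="hilbertType")]
HB.structure Definition Hilbert (R : realType) :=
  {H of CompleteNormedModule R H & CompleteNormedModule_isHilbert R H}.

Notation "''<' x , y >" := (inner x y)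
  (at level 2, x at level 69, y at level 69, format "''<' x ,  y >")
  : ring_scope.

Section BoundedOperators.
Variables (R : realType) (H : hilbertType R).
Implicit Types (U V M : H -> H) (x y : H).

Definition bounded_op U := exists c : R, forall x, `|U x| <= c * `|x|.

Definition self_adjoint U := forall x y, '<U x, y> = '<x, U y>.

Definition SH : set (H -> H) :=
  [set U | [/\ linear U, bounded_op U & self_adjoint U]].

(* [succeq_op U V] is the Loewner order, U above V. *)
Definition succeq_op U V := forall x, '<V x, x> <= '<U x, x>.

Definition SH_ge (s : R) : set (H -> H) :=
  [set U | SH U /\ succeq_op U (fun x => s *: x)].

(* [sup] is real-valued, hence meaningful only when [U] is bounded. *)
Definition op_norm U : R := sup [set `|U x| | x in [set x | `|x| <= 1]].

Definition norm_op M x : R := Num.sqrt '<M x, x>.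

(* A genuine inverse only when [M] is bijective, which holds for every
   element of [SH_ge s] with [0 < s]. *)
Definition inv_op M : H -> H := pinv setT M.

End BoundedOperators.

(* Set-valued operators: [A x] is the set of values at [x], and [A x u] says
   that (x, u) is in the graph of [A]. *)
Section SetValuedOperators.
Variables (R : realType) (H : hilbertType R).
Implicit Types (A T : H -> set H) (B M : H -> H).

Definition strongly_monotone (g : R) A :=
  forall x y u v, A x u -> A y v -> g * `|x - y| ^+ 2 <= '<x - y, u - v>.

Definition monotone_op A := strongly_monotone 0 A.

Definition maximally_monotone A :=
  monotone_op A /\
  forall T, monotone_op T -> (forall x, A x `<=` T x) -> T = A.

Definition single_valued B : H -> set H := fun x => [set B x].

Definition cocoercive (b : R) B :=
  forall x y, b * `|B x - B y| ^+ 2 <= '<x - y, B x - B y>.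

Definition add_op A T : H -> set H :=
  fun x => [set w | exists u v, [/\ A x u, T x v & w = u + v]].

Definition zer A : set H := [set x | A x 0].

Definition converse_op A : H -> set H := fun y => [set x | A x y].

(* (Id + M^-1 A)^-1, as a set-valued operator: [resolvent M A y p] says that p
   is a value of it at y. There is at most one such p when [A] is monotone and
   [M] is in [SH_ge s] with [0 < s], so that it then reads p = J_A^M y. *)
Definition resolvent M A : H -> set H :=
  converse_op (add_op (single_valued idfun) (fun x => inv_op M @` A x)).

Definition weakly_cvg (z : nat -> H) (l : H) :=
  forall y, '<z k, y> @[k --> \oo] --> '<l, y>.

End SetValuedOperators.

Section Iterates.
Variables (R : realType) (H : hilbertType R).
Variables (zm1 : H) (z : nat -> H).

(* z_k - z_(k-1), where [zm1] stands for z_(-1) *)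
Definition increment (k : nat) : H := z k - (if k is j.+1 then z j else zm1).

Definition increment_gauge (M : nat -> H -> H) (k : nat) : R :=
  Num.max (norm_op (M k) (increment k)) (norm_op (M k) (increment k) ^+ 2).

End Iterates.

(* Main.v *)
(* Every step satisfies
     |p_k - z*|^2 + (kappa / 2) |zbar_k - p_k|^2 + delta |B zbar_k - B z*|^2
       <= |zbar_k - z*|^2
   in the metric M_k, where p_k = z_(k+1) - eps_k, z* is any zero and delta > 0.
   Hence |z_k - z*|_(M_k) is quasi-monotone with summable errors and converges,
   zbar_k - p_k -> 0 and B zbar_k -> B z*. The resolvent inclusion then supplies
   points of the graph of A at p_k whose values converge strongly to - B z*, so
   by maximality every weak limit of (z_k) along an ultrafilter is a zero.
   The M_k converge strongly, and Opial's argument shows that all these limits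
   coincide. Under strong monotonicity the step is a strict contraction up to
   the inertial error, which gives the linear rate. *)
Require Import Defs.
From HB Require Import structures.
From mathcomp Require Import all_boot all_order all_algebra.
From mathcomp Require Import all_classical all_reals all_analysis.
From mathcomp Require Import ring lra.

Set Implicit Arguments.
Unset Strict Implicit.
Unset Printing Implicit Defensive.

Import Order.TTheory GRing.Theory Num.Theory.
Import numFieldNormedType.Exports.

Local Open Scope classical_set_scope.
Local Open Scope ring_scope.

(** * Inner product calculus *)

Section InnerProduct.
Variables (R : realType) (H : hilbertType R).
Implicit Types (x y : H) (a : R).

Lemma innerC x y : '<x, y> = '<y, x>.
Proof. by rewrite hermC expr0 mul1r. Qed.

Lemma innerDr x y1 y2 : '<x, y1 + y2> = '<x, y1> + '<x, y2>.
Proof. exact: raddfD. Qed.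

Lemma innerZr a x y : '<x, a *: y> = a * '<x, y>.
Proof. exact: linearZ. Qed.

Lemma innerNr x y : '<x, - y> = - '<x, y>.
Proof. exact: raddfN. Qed.

Lemma inner0r x : '<x, 0> = 0.
Proof. exact: raddf0. Qed.

Lemma innerDl x1 x2 y : '<x1 + x2, y> = '<x1, y> + '<x2, y>.
Proof. by rewrite innerC innerDr !(innerC y). Qed.

Lemma innerZl a x y : '<a *: x, y> = a * '<x, y>.
Proof. by rewrite innerC innerZr innerC. Qed.

Lemma innerNl x y : '<- x, y> = - '<x, y>.
Proof. by rewrite innerC innerNr innerC. Qed.

Lemma inner0l x : '<0, x> = 0.
Proof. by rewrite innerC inner0r. Qed.

Definition innerE := (innerDl, innerDr, innerNl, innerNr, innerZl, innerZr).

Lemma inner_sqr x : '<x, x> = `|x| ^+ 2.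
Proof.
rewrite norm_inner sqr_sqrtr //.
have [->|x0] := eqVneq x 0; first by rewrite inner0l.
exact/ltW/neq0_dnorm_gt0.
Qed.

End InnerProduct.

(** * Self-adjoint operators and the seminorms of positive ones *)

Section SelfAdjoint.
Variables (R : realType) (H : hilbertType R).
Implicit Types (U M : H -> H) (x y : H) (a : R).

Lemma SH_id : SH (@idfun H).
Proof. by split=> //; exists 1 => x; rewrite mul1r. Qed.

Lemma SHD U x y : SH U -> U (x + y) = U x + U y.
Proof. by case=> /(_ 1 x y) + _ _; rewrite !scale1r. Qed.

Lemma SH0 U : SH U -> U 0 = 0.
Proof. by move=> sU; apply: (@addrI _ (U 0)); rewrite -(SHD _ _ sU) !addr0. Qed.

Lemma SHZ U a x : SH U -> U (a *: x) = a *: U x.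
Proof. by move=> sU; have [/(_ a x 0) + _ _] := sU; rewrite (SH0 sU) !addr0. Qed.

Lemma SHN U x : SH U -> U (- x) = - U x.
Proof. by move=> sU; rewrite -scaleN1r (SHZ _ _ sU) scaleN1r. Qed.

Definition SHE U (sU : SH U) :=
  (fun x y => SHD x y sU, fun x => SHN x sU, fun a x => SHZ a x sU).

Lemma SHC U x y : SH U -> '<U x, y> = '<U y, x>.
Proof. by case=> _ _ sU; rewrite sU innerC. Qed.

Lemma SH_bound U : SH U -> exists2 c : R, 0 <= c & forall x, `|U x| <= c * `|x|.
Proof.
case=> _ [c Uc] _; exists `|c| => // x.
by rewrite (le_trans (Uc x)) // ler_wpM2r // ler_norm.
Qed.

Lemma SHDop U M : SH U -> SH M -> SH (fun x => U x + M x).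
Proof.
move=> sU sM; split.
- by move=> a x y; rewrite !(SHE sU) !(SHE sM) scalerDr addrACA.
- have [c _ Uc] := SH_bound sU; have [d _ Md] := SH_bound sM.
  exists (c + d) => x; rewrite mulrDl (le_trans (ler_normD _ _)) //.
  by rewrite lerD.
- by move=> x y; rewrite !innerE (SHC _ _ sU) (SHC _ _ sM) !(innerC x).
Qed.

Lemma SHZop U a : SH U -> SH (fun x => a *: U x).
Proof.
move=> sU; split.
- by move=> b x y; rewrite !(SHE sU) scalerDr !scalerA mulrC.
- have [c _ Uc] := SH_bound sU.
  by exists (`|a| * c) => x; rewrite normrZ -mulrA ler_wpM2l.
- by move=> x y; rewrite !innerE (SHC _ _ sU) !(innerC x).
Qed.

Lemma SH_ge_inner s M x : SH_ge s M -> s * `|x| ^+ 2 <= '<M x, x>.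
Proof. by case=> _ /(_ x); rewrite innerZl inner_sqr. Qed.

Lemma SH_ge_psd s M : 0 <= s -> SH_ge s M -> forall x, 0 <= '<M x, x>.
Proof.
by move=> s0 sM x; rewrite (le_trans _ (SH_ge_inner _ sM)) // mulr_ge0.
Qed.

(* Nonnegativity of the quadratic t -> <M (x + t y), x + t y>. *)
Lemma psd_CauchySchwarz M x y : SH M -> (forall x, 0 <= '<M x, x>) ->
  '<M x, y> ^+ 2 <= '<M x, x> * '<M y, y>.
Proof.
move=> sM M0; set b := '<M x, y>; set a := '<M x, x>; set c := '<M y, y>.
have q t : 0 <= a + 2 * t * b + t ^+ 2 * c.
  have := M0 (x + t *: y); rewrite !(SHE sM) !innerE (SHC y x sM) -/a -/b -/c.
  by congr (0 <= _); ring.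
have c0 : 0 <= c := M0 y.
have [c0'|c0'] := eqVneq c 0.
  have [->|b0] := eqVneq b 0; first by rewrite expr0n mulr_ge0 //; exact: M0.
  (* With c = 0 the quadratic is affine in t, and this t gives it the value -1. *)
  have := q (- (a + 1) / (2 * b)); rewrite c0' mulr0 addr0.
  have -> : a + 2 * (- (a + 1) / (2 * b)) * b = -1 by field.
  by rewrite ler0N1.
(* The minimiser of the quadratic. *)
have := q (- b / c).
have -> : a + 2 * (- b / c) * b + (- b / c) ^+ 2 * c = (a * c - b ^+ 2) / c.
  by field.
by rewrite pmulr_lge0 ?invr_gt0 ?lt_def ?c0' // subr_ge0.
Qed.

Lemma normr_inner_le x y : `|'<x, y>| <= `|x| * `|y|.
Proof.
rewrite -(@ler_pXn2r _ 2) ?nnegrE ?mulr_ge0 // exprMn -!inner_sqr real_normK ?num_real //.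
by apply: (psd_CauchySchwarz _ _ SH_id) => z; rewrite inner_sqr sqr_ge0.
Qed.

Lemma norm_opE M x : (forall x, 0 <= '<M x, x>) -> norm_op M x ^+ 2 = '<M x, x>.
Proof. by move=> M0; rewrite sqr_sqrtr. Qed.

Lemma norm_op_ge0 M x : 0 <= norm_op M x.
Proof. exact: sqrtr_ge0. Qed.

Lemma norm_opZ M a x : SH M -> (forall x, 0 <= '<M x, x>) ->
  norm_op M (a *: x) = `|a| * norm_op M x.
Proof.
move=> sM M0; apply/eqP; rewrite -(@eqrXn2 _ 2) ?mulr_ge0 ?norm_op_ge0 //.
by rewrite exprMn !norm_opE // real_normK ?num_real // !(SHE sM) !innerE mulrA.
Qed.

Lemma norm_opD M x y : SH M -> (forall x, 0 <= '<M x, x>) ->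
  norm_op M (x + y) <= norm_op M x + norm_op M y.
Proof.
move=> sM M0; rewrite -(@ler_pXn2r _ 2) ?nnegrE ?addr_ge0 ?norm_op_ge0 //.
rewrite norm_opE // !(SHE sM) !innerE sqrrD !norm_opE // (SHC y x sM) mulr2n.
have : '<M x, y> <= norm_op M x * norm_op M y.
  rewrite (le_trans (ler_norm _)) //.
  rewrite -(@ler_pXn2r _ 2) ?nnegrE ?mulr_ge0 ?norm_op_ge0 //.
  rewrite exprMn !norm_opE // real_normK ?num_real //; exact: psd_CauchySchwarz.
by lra.
Qed.

Lemma norm_op_le M c x : 0 <= c -> `|M x| <= c * `|x| -> '<M x, x> <= c * `|x| ^+ 2.
Proof.
move=> c0 Mc; rewrite (le_trans (ler_norm _)) // (le_trans (normr_inner_le _ _)) //.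
by rewrite expr2 mulrA ler_wpM2r.
Qed.

(* Cauchy-Schwarz for the form of [M], tested against [M x]. *)
Lemma psd_sqr_norm M c x : 0 <= c -> SH M -> (forall x, 0 <= '<M x, x>) ->
  (forall x, `|M x| <= c * `|x|) -> `|M x| ^+ 2 <= c * '<M x, x>.
Proof.
move=> c0 sM M0 Mc; have := psd_CauchySchwarz x (M x) sM M0.
rewrite inner_sqr => h1.
have [->|Mx0] := eqVneq (M x) 0; first by rewrite normr0 expr0n inner0l mulr0.
have h2 : '<M (M x), M x> <= c * `|M x| ^+ 2 by apply: norm_op_le.
have Mx2 : 0 < `|M x| ^+ 2 by rewrite exprn_gt0 // normr_gt0.
rewrite -(ler_pM2r Mx2) -expr2 (le_trans h1) //.
by rewrite (le_trans (ler_wpM2l (M0 x) h2)) // mulrCA mulrA.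
Qed.

(** Homogeneity reduces the bound to the unit vector x / |x|; boundedness of [U] makes the supremum
    a true upper bound. *)
Lemma op_norm_ge U x : SH U -> `|U x| <= op_norm U * `|x|.
Proof.
move=> sU; have [c c0 Uc] := SH_bound sU.
have [->|x0] := eqVneq x 0; first by rewrite (SH0 sU) normr0 mulr0.
have x0' : 0 < `|x| by rewrite normr_gt0.
rewrite -ler_pdivrMr //.
have -> : `|U x| / `|x| = `|U (`|x|^-1 *: x)|.
  by rewrite (SHZ _ _ sU) normrZ normfV normr_id mulrC.
apply: ub_le_sup.
  exists c => _ [y /= y1 <-]; rewrite (le_trans (Uc _)) // -[leRHS]mulr1.
  exact: ler_wpM2l.
by exists (`|x|^-1 *: x) => //=; rewrite normrZ normfV normr_id mulVf ?gt_eqF.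
Qed.

End SelfAdjoint.

(** * Squeeze principles and limits of inner products along filters *)

Section StrongLimits.
Variables (R : realType) (H : hilbertType R).

Lemma squeeze_norm0 (V : normedModType R) T (F : set_system T) {FF : Filter F}
    (f : T -> V) (g : T -> R) :
  (forall t, `|f t| <= g t) -> g t @[t --> F] --> 0 -> f t @[t --> F] --> 0.
Proof.
move=> fg g0; apply/norm_cvg0P.
apply: (squeeze_cvgr _ (cvg_cst 0) g0).
by apply: nearW => t; rewrite normr_ge0 fg.
Qed.

Lemma squeeze_sqr_norm0 (V : normedModType R) T (F : set_system T)
    {FF : Filter F} (f : T -> V) (g : T -> R) :
  (forall t, `|f t| ^+ 2 <= g t) -> g t @[t --> F] --> 0 -> f t @[t --> F] --> 0.
Proof.
move=> fg g0; apply/cvgr0Pnorm_lt => e e0.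
have e20 : 0 < e ^+ 2 by rewrite exprn_gt0.
move/cvgr0Pnorm_lt : g0 => /(_ _ e20); apply: filterS => t gt.
rewrite -(@ltr_pXn2r _ 2) ?nnegrE ?(ltW e0) //.
by rewrite (le_lt_trans (fg t)) // (le_lt_trans (ler_norm _)).
Qed.

(** Weak against strong convergence: <u, v - l> tends to 0 by Cauchy-Schwarz because u is bounded,
    so testing u against [l] suffices. *)
Lemma cvg_inner_bounded T (F : set_system T) {FF : Filter F}
    (u v : T -> H) (l : H) (c a : R) :
  (forall t, `|u t| <= c) -> '<u t, l> @[t --> F] --> a ->
  v t @[t --> F] --> l -> '<u t, v t> @[t --> F] --> a.
Proof.
move=> uc ul vl.
have vl0 : '<u t, v t - l> @[t --> F] --> 0.
  apply: (squeeze_norm0 (g := fun t => c * `|v t - l|)).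
    by move=> t; rewrite (le_trans (normr_inner_le _ _)) // ler_wpM2r.
  rewrite -(mulr0 c); apply: cvgMr; rewrite -[X in _ --> X](@normr0 _ H).
  by apply: cvg_norm; apply/subr_cvg0.
have -> : (fun t => '<u t, v t>) = (fun t => '<u t, l> + '<u t, v t - l>).
  by apply/funext => t; rewrite -innerDr [l + _]addrC subrK.
by rewrite -[a]addr0; exact: cvgD.
Qed.

Lemma cvg_innerr T (F : set_system T) {FF : Filter F} (u : T -> H) (l y : H) :
  u t @[t --> F] --> l -> '<y, u t> @[t --> F] --> '<y, l>.
Proof.
by apply: (@cvg_inner_bounded _ _ _ (fun=> y) _ l `|y|) => //; exact: cvg_cst.
Qed.

Lemma cvg_innerl T (F : set_system T) {FF : Filter F} (u : T -> H) (l y : H) :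
  u t @[t --> F] --> l -> '<u t, y> @[t --> F] --> '<l, y>.
Proof.
by move=> ul; rewrite innerC; under eq_fun do rewrite innerC; exact: cvg_innerr.
Qed.

Lemma cauchy_sqr_cvgn (V : completeNormedModType R) (u : nat -> V)
    (w : nat -> R) :
  (forall k l, (k <= l)%N -> `|u k - u l| ^+ 2 <= w k) ->
  w @ \oo --> 0 -> cvgn u.
Proof.
move=> uw w0; apply/cauchy_cvgP/cauchy_exP => e e0.
have e20 : 0 < e ^+ 2 by rewrite exprn_gt0.
move/cvgr0Pnorm_lt : w0 => /(_ _ e20) [K _ wK].
exists (u K); exists K => // l /= Kl; rewrite -ball_normE /=.
rewrite -(@ltr_pXn2r _ 2) ?nnegrE ?(ltW e0) //.
by rewrite (le_lt_trans (uw _ _ Kl)) // (le_lt_trans (ler_norm _)) // wK /=.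
Qed.

End StrongLimits.

(** * Riesz representation and weak compactness through ultrafilters *)

Section LaxMilgram.
Variables (R : realType) (H : hilbertType R).

(* [x] minimises J x = <M x, x> - 2 f x; minimising sequences are Cauchy by
   J x + J y = 2 J ((x + y) / 2) + <M (x - y), x - y> / 2. *)
Lemma symmetric_Lax_Milgram (s : R) (M : H -> H) (f : H -> R) :
  0 < s -> SH_ge s M -> scalar f -> (exists c, forall x, `|f x| <= c * `|x|) ->
  exists x, forall y, '<M x, y> = f y.
Proof.
move=> s0 sM fl [c fc]; have SM := sM.1; have M0 := SH_ge_psd (ltW s0) sM.
pose J x := '<M x, x> - 2 * f x.
have fD x y : f (x + y) = f x + f y.
  by have := fl 1 x y; rewrite scale1r /= mul1r.
have f0 : f 0 = 0 by apply: (@addrI _ (f 0)); rewrite -fD !addr0.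
have fZ a x : f (a *: x) = a * f x by have := fl a x 0; rewrite f0 !addr0.
(* Completing the square in s |x|^2 - 2 c |x|. *)
have Jb x : - (c ^+ 2 / s) <= J x.
  rewrite lerNl /J.
  have := SH_ge_inner x sM; have := fc x; rewrite ler_norml => /andP[_ h1] h2.
  rewrite ler_pdivlMr // opprB.
  have : 0 <= (s * `|x| - c) ^+ 2 by rewrite sqr_ge0.
  have : s * (s * `|x| ^+ 2) <= s * '<M x, x> by rewrite (ler_pM2l s0).
  have : s * f x <= s * (c * `|x|) by rewrite (ler_pM2l s0).
  by nra.
have Jinf : has_inf (range J).
  by split; [exists (J 0), 0|exists (- (c ^+ 2 / s)) => _ [x _ <-]].
set m := inf (range J).
have Jm x : m <= J x by apply: ge_inf; [exact: Jinf.2|exists x].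
have /choice[x xP] n : exists x, J x < m + n.+1%:R^-1.
  have [_ [x _ <-] xm] := inf_adherent (ltac:(by []) : 0 < n.+1%:R^-1 :> R) Jinf.
  by exists x.
have inv0 : n.+1%:R^-1 @[n --> \oo] --> (0 : R) by exact: cvg_harmonic.
have xC : cvgn x.
  apply: (@cauchy_sqr_cvgn _ _ _ (fun n => 4 / s * n.+1%:R^-1)); last first.
    by rewrite -(mulr0 (4 / s)); apply: cvgMr.
  move=> k l kl; have hm := Jm (2^-1 *: (x k + x l)).
  have hs := SH_ge_inner (x k - x l) sM.
  have : '<M (x k - x l), x k - x l> =
      2 * J (x k) + 2 * J (x l) - 4 * J (2^-1 *: (x k + x l)).
    by rewrite /J fZ fD !(SHE SM) !innerE (SHC (x l) _ SM); field.
  have := xP k; have := xP l.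
  have : l.+1%:R^-1 <= k.+1%:R^-1 :> R by rewrite lef_pV2 ?posrE // ler_nat.
  rewrite mulrAC ler_pdivlMr // (mulrC _ s).
  set a := l.+1%:R^-1; set b := k.+1%:R^-1.
  by move: (J _) (J _) hm hs => ? ? ? ? ? ? ? ?; lra.
exists (limn x) => h; set l := limn x.
have gl : '<M (x n), h> - f h @[n --> \oo] --> '<M l, h> - f h.
  apply: cvgB; last exact: cvg_cst.
  case: SM => _ _ sa; rewrite sa; under eq_fun do rewrite sa.
  exact: cvg_innerl.
set g := '<M l, h> - f h in gl.
(* Variation in the direction h: J (x_n + t h) >= m > J x_n - 1 / (n + 1), passed to the limit in
   n. *)
have gt t : - (2 * t * g) <= t ^+ 2 * '<M h, h>.
  have lim1 : t ^+ 2 * '<M h, h> + n.+1%:R^-1 + 2 * t * ('<M (x n), h> - f h)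
      @[n --> \oo] --> t ^+ 2 * '<M h, h> + 0 + 2 * t * g.
    apply: cvgD; [apply: cvgD => //; exact: cvg_cst|exact: cvgMr].
  have : 0 <= t ^+ 2 * '<M h, h> + 0 + 2 * t * g.
    apply: (cvgr_to_ge lim1); apply: nearW => n.
    have := Jm (x n + t *: h); have := xP n.
    rewrite /J fD fZ !(SHE SM) !innerE (SHC h _ SM).
    by set d := n.+1%:R^-1; lra.
  by lra.
apply/eqP; rewrite -subr_eq0 -/g; apply/eqP.
set b := '<M h, h> in gt; have b0 : 0 <= b := M0 h.
(* For b > 0 the best choice is t = - g / b; the shift by 1 also covers b = 0 and yields 2 (b + 1)
   <= b unless g = 0. *)
have := gt (- g / (b + 1)).
have b1 : 0 < b + 1 by rewrite ltr_wpDl.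
have -> : - (2 * (- g / (b + 1)) * g) = g ^+ 2 * (2 / (b + 1)).
  by field; rewrite gt_eqF.
have -> : (- g / (b + 1)) ^+ 2 * b = g ^+ 2 * (b / (b + 1) ^+ 2).
  by field; rewrite gt_eqF.
have [//|g0] := eqVneq g 0.
have g2 : 0 < g ^+ 2 by rewrite exprn_even_gt0.
rewrite ler_pM2l // ler_pdivlMr ?exprn_gt0 //.
have -> : 2 / (b + 1) * (b + 1) ^+ 2 = 2 * (b + 1) by field; rewrite gt_eqF.
by lra.
Qed.

Lemma Riesz (f : H -> R) : scalar f -> (exists c, forall x, `|f x| <= c * `|x|) ->
  exists x, forall y, '<x, y> = f y.
Proof.
apply: (@symmetric_Lax_Milgram 1 idfun) => //; split; first exact: SH_id.
by move=> x; rewrite scale1r.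
Qed.

(** Lax-Milgram makes [M] surjective, and a pseudo-inverse is a right inverse on the range. *)
Lemma inv_opK (s : R) (M : H -> H) : 0 < s -> SH_ge s M ->
  forall y, M (inv_op M y) = y.
Proof.
move=> s0 sM y; rewrite /inv_op pinvK // inE /=.
have [||x xy] := symmetric_Lax_Milgram s0 sM (f := fun x => '<y, x>).
- by move=> a u v; rewrite !innerE.
- by exists `|y| => u; exact: normr_inner_le.
exists x => //; apply/eqP; rewrite -subr_eq0 -normr_eq0 -sqrf_eq0 -inner_sqr.
by rewrite {1}innerDl innerNl xy subrr.
Qed.

(** Takes the place of weak sequential compactness. Each bounded real sequence <z k, y> has a limit
    along [F] by compactness of a segment; the limit is a bounded linear functional of y, which
    Riesz represents by a vector. *)
Lemma ultra_weak_cvg (F : set_system nat) (z : nat -> H) (c : R) :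
  UltraFilter F -> (forall k, `|z k| <= c) ->
  exists x, forall y, '<z k, y> @[k --> F] --> '<x, y>.
Proof.
move=> FU zc.
have /choice[f fP] y : exists a : R, '<z k, y> @[k --> F] --> a.
  (* An ultrafilter decides every preimage, so its image in the reals is again an ultrafilter. *)
  have Fy : UltraFilter ('<z k, y> @[k --> F]).
    split=> [|G GF FG]; first exact: fmap_proper_filter.
    apply/seteqP; split=> // A GA /=.
    have [//|FnA] := in_ultra_setVsetC ((fun k => '<z k, y>) @^-1` A) FU.
    have /FG GnA : ('<z k, y> @[k --> F]) (~` A) by [].
    by have [t []] := filter_ex (filterI GA GnA).
  have := @segment_compact R (- (c * `|y|)) (c * `|y|).
  rewrite compact_ultra => /(_ _ Fy)[|a [_ aP]]; last by exists a.
  apply: (@filterS _ F _ setT _ _ filterT) => k _.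
  rewrite /= in_itv -ler_norml /=.
  by apply: (le_trans (normr_inner_le _ _)); rewrite ler_wpM2r.
have fl : scalar f.
  move=> a u v; have h : '<z k, a *: u + v> @[k --> F] --> a * f u + f v.
    under eq_fun do rewrite innerDr innerZr.
    by apply: cvgD => //; exact: cvgMr.
  by rewrite -(cvg_lim _ h) //; exact/esym/(cvg_lim _ (fP _)).
have fc : exists c, forall x, `|f x| <= c * `|x|.
  exists c => x; apply: (cvgr_to_le (cvg_norm (fP x))); apply: nearW => k.
  by rewrite (le_trans (normr_inner_le _ _)) // ler_wpM2r.
have [x xf] := Riesz fl fc.
by exists x => y; rewrite xf.
Qed.

(* If convergence to [l] failed, it would fail along some ultrafilter. *)
Lemma weakly_cvg_ultra (z : nat -> H) (c : R) (l : H) :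
  (forall k, `|z k| <= c) ->
  (forall (F : set_system nat) x, UltraFilter F -> F --> \oo ->
    (forall y, '<z k, y> @[k --> F] --> '<x, y>) -> x = l) ->
  weakly_cvg z l.
Proof.
move=> zc zl y; apply/cvgrPdist_lt => e e0.
pose A : set nat := [set k | `|'<l, y> - '<z k, y>| < e].
apply: contrapT => nA.
(* Since [A] contains no tail, every tail meets its complement. *)
have PF : ProperFilter (within (~` A) \oo).
  apply: Build_ProperFilter_ex => B; rewrite /within /= => wB.
  apply: contrapT => nB; apply: nA; apply: filterS wB => k /= kB.
  by apply: contrapT => kA; apply: nB; exists k; exact: kB.
have [F [FU FA]] := ultraFilterLemma PF.
have Foo : F --> \oo by move=> B Boo; apply: FA; apply: filterS Boo => k.
have [x xP] := ultra_weak_cvg FU zc.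
have FnA : F (~` A) by apply: FA; exact: withinT.
have := xP y; rewrite (zl _ _ FU Foo xP) => /cvgrPdist_lt/(_ _ e0) FA'.
by have [k []] := filter_ex (filterI FA' FnA).
Qed.

End LaxMilgram.

(** * Perturbed monotone and geometric recursions for real sequences *)

Section RealSequences.
Variables (R : realType) (eta : nat -> R).
Hypotheses (eta0 : forall k, 0 <= eta k) (eta_cvg : cvgn (series eta)).

Let P n := \prod_(0 <= j < n) (1 + eta j).

Lemma prod_ge1 n : 1 <= P n.
Proof.
rewrite /P; elim: n => [|n ih]; first by rewrite big_nil.
by rewrite big_nat_recr //= -[leLHS]mulr1 ler_pM // lerDl.
Qed.

Let Pgt0 n : 0 < P n. Proof. exact: lt_le_trans (prod_ge1 n). Qed.

Let PS n : P n.+1 = P n * (1 + eta n). Proof. by rewrite /P big_nat_recr. Qed.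

Lemma series_le_lim (u : nat -> R) n : (forall k, 0 <= u k) -> cvgn (series u) ->
  series u n <= limn (series u).
Proof.
move=> u0 ucv; apply: nondecreasing_cvgn_le => //.
by apply/nondecreasing_seqP => k; rewrite !seriesEnat /= big_nat_recr //= lerDl.
Qed.

(** The partial products increase and stay below the exponential of the sum, since 1 + t <= exp
    t. *)
Lemma cvgn_prod1D : cvgn P.
Proof.
apply: nondecreasing_is_cvgn.
  by apply/nondecreasing_seqP => n; rewrite PS ler_pMr // lerDl.
exists (expR (limn (series eta))) => _ [n _ <-].
apply: (@le_trans _ _ (expR (series eta n))); last first.
  by rewrite ler_expR series_le_lim.
rewrite seriesEnat /= /P; elim: n => [|n ih]; first by rewrite !big_nil expR0.
rewrite !big_nat_recr //= expRD ler_pM //; last exact: expR_ge1Dx.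
- exact: ltW (Pgt0 n).
- by rewrite addr_ge0.
Qed.

(* After division by the partial products of the 1 + eta_j the recursion
   becomes b_(k+1) <= b_k + e_k. *)
Lemma quasi_monotone_cvgn (a e : nat -> R) :
  (forall k, 0 <= a k) -> (forall k, 0 <= e k) -> cvgn (series e) ->
  (forall k, a k.+1 <= (1 + eta k) * (a k + e k)) -> cvgn a.
Proof.
move=> a0 e0 ecv ae.
pose b k := (P k)^-1 * a k.
have b0 k : 0 <= b k by rewrite mulr_ge0 // invr_ge0 ltW.
have bS k : b k.+1 <= b k + e k.
  rewrite /b PS ler_pdivrMl ?mulr_gt0 // ?ltr_wpDr //.
  rewrite (le_trans (ae k)) // mulrAC mulrC ler_wpM2r ?addr_ge0 //.
  rewrite mulrDr mulrA mulfV ?gt_eqF // mul1r lerD2l.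
  by rewrite ler_peMl // prod_ge1.
(* Subtracting the accumulated errors leaves a nonincreasing sequence, bounded below by minus their
   total. *)
have : cvgn (b - series e).
  apply: nonincreasing_is_cvgn.
    apply/nonincreasing_seqP => k.
    rewrite !fctE !seriesEnat /= big_nat_recr //=.
    by have := bS k; lra.
  exists (- limn (series e)) => _ [n _ <-]; rewrite !fctE.
  by have := b0 n; have := series_le_lim n e0 ecv; lra.
move=> bcv; have bcv' : cvgn b.
  by rewrite -[b](subrK (series e)); exact: is_cvgD.
have -> : a = P * b.
  by apply/funext => k; rewrite !fctE /b mulrA mulfV ?gt_eqF // mul1r.
by apply: is_cvgM => //; exact: cvgn_prod1D.
Qed.

(** Unrolling by induction. The factor r also multiplies u k, so the latest error enters with
    exponent 1, not 0. *)
Lemma geometric_recursion_le (r : R) (a u : nat -> R) (K : nat) : 0 <= r ->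
  (forall k, (K <= k)%N -> a k.+1 <= r * (a k + u k)) ->
  forall k, (K <= k)%N ->
    a k <= r ^+ (k - K)%N * a K + \sum_(K <= i < k) r ^+ (k - i)%N * u i.
Proof.
move=> r0 au; elim=> [|k ih].
  by rewrite leqn0 => /eqP ->; rewrite subnn expr0 mul1r big_geq // addr0.
rewrite leq_eqVlt => /orP[/eqP <-|Kk].
  by rewrite subnn expr0 mul1r big_geq // addr0.
rewrite (le_trans (au k Kk)) // big_nat_recr //= subSn // subSnn expr1.
rewrite addrA mulrDr lerD2r exprS -mulrA.
have -> : \sum_(K <= i < k) r ^+ (k.+1 - i)%N * u i =
    r * \sum_(K <= i < k) r ^+ (k - i)%N * u i.
  rewrite mulr_sumr; apply: eq_big_nat => i /andP[_ ik].
  by rewrite subSn ?(ltnW ik) // exprS mulrA.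
by rewrite -mulrDr ler_wpM2l // ih.
Qed.

End RealSequences.

(** * Strong convergence of the metrics *)

Section VariableMetric.
Variables (R : realType) (H : hilbertType R).

(** Division by the partial products of the 1 + eta_j gives a Loewner-decreasing sequence N_k of
    positive operators. For k <= l the operator D = N_k - N_l is positive, and [psd_sqr_norm] bounds
    |D x|^2 by a multiple of <N_k x, x> - <N_l x, x>, so N_k x is Cauchy. *)
Lemma variable_metric_cvgn (M : nat -> H -> H) (eta : nat -> R) (c : R) :
  (forall k, SH (M k)) -> (forall k x, 0 <= '<M k x, x>) ->
  (forall k x, `|M k x| <= c * `|x|) ->
  (forall k, 0 <= eta k) -> cvgn (series eta) ->
  (forall k, succeq_op (fun x => (1 + eta k) *: M k x) (M k.+1)) ->
  forall x, cvgn (fun k => M k x).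
Proof.
move=> sM M0 Mc eta0 eta_cv Md x.
pose P n := \prod_(0 <= j < n) (1 + eta j).
have P1 n : 1 <= P n by exact: prod_ge1.
have P0 n : 0 < P n by exact: lt_le_trans (P1 n).
pose N k y := (P k)^-1 *: M k y.
have sN k : SH (N k) by exact: SHZop.
have N0 k y : 0 <= '<N k y, y>.
  by rewrite innerZl mulr_ge0 // invr_ge0 ltW.
have Nd y : {homo (fun k => '<N k y, y>) : k l / (k <= l)%N >-> l <= k}.
  apply/nonincreasing_seqP => k; rewrite /N !innerZl.
  have := Md k y; rewrite innerZl => h.
  have -> : P k.+1 = P k * (1 + eta k) by rewrite /P big_nat_recr.
  have e1 : 0 < 1 + eta k by rewrite ltr_wpDr.
  by rewrite invfM -mulrA ler_pM2l ?invr_gt0 // ler_pdivrMl.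
have Ncv y : cvgn (fun k => '<N k y, y>).
  by apply: nonincreasing_is_cvgn => //; exists 0 => _ [k _ <-].
pose d := `|c| + `|c|.
have Nc k y : `|N k y| <= `|c| * `|y|.
  rewrite normrZ ger0_norm ?invr_ge0 ?(ltW (P0 k)) //.
  rewrite ler_pdivrMl // (le_trans (Mc k y)) //.
  rewrite (le_trans (ler_wpM2r _ (ler_norm c))) // ler_peMl ?mulr_ge0 //.
have NC : cvgn (fun k => N k x).
  pose L := limn (fun k => '<N k x, x>).
  apply: (@cauchy_sqr_cvgn _ _ _ (fun k => d * ('<N k x, x> - L))).
    move=> k l kl; pose D y := N k y + (-1) *: N l y.
    have sD : SH D by apply: SHDop => //; exact: SHZop.
    have DE y : '<D y, y> = '<N k y, y> - '<N l y, y>.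
      by rewrite /D scaleN1r innerDl innerNl.
    have D0 y : 0 <= '<D y, y> by rewrite DE subr_ge0 Nd.
    have Dd y : `|D y| <= d * `|y|.
      by rewrite /D (le_trans (ler_normD _ _)) // scaleN1r normrN mulrDl lerD.
    have d0 : 0 <= d by rewrite addr_ge0.
    have := psd_sqr_norm x d0 sD D0 Dd.
    rewrite {1}/D scaleN1r DE => h; apply: (le_trans h).
    rewrite ler_wpM2l // lerD2l lerN2.
    exact: nonincreasing_cvgn_ge.
  rewrite -(mulr0 d); apply: cvgMr; rewrite -(subrr L).
  by apply: cvgB; [exact: Ncv|exact: cvg_cst].
have -> : (fun k => M k x) = (fun k => P k *: N k x).
  by apply/funext => k; rewrite /N scalerA mulfV ?gt_eqF // scale1r.
by apply: is_cvgZ => //; exact: cvgn_prod1D.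
Qed.

End VariableMetric.

(** * Energy estimates for one forward-backward step *)

Section ForwardBackwardStep.
Variables (R : realType) (H : hilbertType R).
Implicit Types (A : H -> set H) (B M : H -> H) (x y p zs : H).

(** Adjoining (x, u) to the graph keeps it monotone, so by maximality the pair lies in it
    already. *)
Lemma maximally_monotone_mem A x u : maximally_monotone A ->
  (forall v w, A v w -> 0 <= '<x - v, u - w>) -> A x u.
Proof.
move=> [Am Amax] h; pose T y := A y `|` [set w | y = x /\ w = u].
have TA : T = A.
  apply: Amax => [y1 y2 w1 w2|y w Ayw]; last by left.
  rewrite mul0r; case=> [A1|[-> ->]]; case=> [A2|[-> ->]].
  - by have := Am _ _ _ _ A1 A2; rewrite mul0r.
  - by rewrite -(opprB x) -(opprB u) innerNl innerNr opprK h.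
  - exact: h.
  - by rewrite subrr inner0l.
by rewrite -TA; right.
Qed.

Lemma zer_addP A B x : zer (add_op A (single_valued B)) x <-> A x (- B x).
Proof.
split=> [[u [_ [Axu -> /esym/eqP]]]|ABx].
  by rewrite addr_eq0 => /eqP <-.
by exists (- B x), (B x); split => //; rewrite addNr.
Qed.

(** Applying [M] to y - M^-1 b = p + M^-1 a, with a in A p, isolates a. *)
Lemma resolvent_mem (s : R) M A y b p : 0 < s -> SH_ge s M ->
  resolvent M A (y - inv_op M b) p -> A p (M (y - p) - b).
Proof.
move=> s0 sM [_ [_ [-> [a Aa <-] e]]].
have SM := sM.1; have MK := inv_opK s0 sM.
suff -> : M (y - p) - b = a by [].
have := congr1 M e; rewrite !(SHE SM) !MK => {}e.
by rewrite addrAC e addrAC subrr add0r.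
Qed.

Lemma inner_young (c : R) x y : 0 < c ->
  2 * '<x, y> <= c * `|x| ^+ 2 + `|y| ^+ 2 / c.
Proof.
move=> c0; have : 0 <= '<c *: x - y, c *: x - y> by rewrite inner_sqr sqr_ge0.
rewrite !innerE (innerC y) !inner_sqr => h; rewrite -(ler_pM2l c0).
have -> : c * (c * `|x| ^+ 2 + `|y| ^+ 2 / c) = c * (c * `|x| ^+ 2) + `|y| ^+ 2.
  by field; rewrite gt_eqF.
lra.
Qed.

Variables (A : H -> set H) (B M : H -> H) (gA : R) (y p zs : H).
Hypotheses (A_strong : strongly_monotone gA A) (SM : SH M).
Hypotheses (ABzs : A zs (- B zs)) (Ap : A p (M (y - p) - B y)).

Let b := B y - B zs.

(** Strong monotonicity of [A] at p and [zs]; expanding y - zs = (y - p) + (p - zs) turns <M (y -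
    p), p - zs> into squared distances. *)
Lemma backward_step :
  '<M (p - zs), p - zs> + 2 * gA * `|p - zs| ^+ 2 + '<M (y - p), y - p> +
    2 * '<y - zs, b> - 2 * '<y - p, b> <= '<M (y - zs), y - zs>.
Proof.
have := A_strong Ap ABzs.
have -> : y - zs = (y - p) + (p - zs) by rewrite addrA subrK.
have -> : M (y - p) - B y - - B zs = M (y - p) - b.
  by rewrite /b opprK opprB addrA addrAC.
move: (y - p) (p - zs) b => u v b'.
rewrite (SHD _ _ SM) !innerE (SHC v u SM) (innerC v) (innerC v b').
lra.
Qed.

Variable beta : R.
Hypotheses (beta0 : 0 < beta) (B_coco : cocoercive beta B).

(** Co-coercivity supplies 2 beta |b|^2, and Young with weight c bounds the cross term 2 <y - p, b>.
    The metric absorbs c |y - p|^2 and leaves the surplus d. *)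
Lemma cocoercive_step (c d : R) : 0 <= gA -> 0 < c ->
  (forall x, (c + d) * `|x| ^+ 2 <= '<M x, x>) ->
  '<M (p - zs), p - zs> + d * `|y - p| ^+ 2 + (2 * beta - c^-1) * `|b| ^+ 2
    <= '<M (y - zs), y - zs>.
Proof.
move=> gA0 c0 Mcd; have := backward_step.
have := B_coco y zs; rewrite -/b.
have := inner_young (y - p) b c0.
have := Mcd (y - p).
have : 0 <= gA * `|p - zs| ^+ 2 by rewrite mulr_ge0.
by lra.
Qed.

(** Of the two copies of <y - zs, b>, one is spent on co-coercivity and the other on strong
    monotonicity of [B]. Young with weight 1 / beta then uses up beta |b|^2 exactly, hence the lower
    bound 1 / beta on the metric. *)
Lemma strongly_monotone_step (gB : R) :
  strongly_monotone gB (single_valued B) ->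
  (forall x, beta^-1 * `|x| ^+ 2 <= '<M x, x>) ->
  '<M (p - zs), p - zs> + 2 * gA * `|p - zs| ^+ 2 + gB * `|y - zs| ^+ 2
    <= '<M (y - zs), y - zs>.
Proof.
move=> Bs Mb; have := backward_step.
have := B_coco y zs; rewrite -/b.
have ib : 0 < beta^-1 by rewrite invr_gt0.
have := inner_young (y - p) b ib; rewrite invrK.
have := Mb (y - p).
have := Bs y zs _ _ erefl erefl; rewrite -/b.
by lra.
Qed.

End ForwardBackwardStep.

(** * Opial's argument in a variable metric *)

Section VariableMetricOpial.
Variables (R : realType) (H : hilbertType R).

(** For weak limits x and l, convergence of both distances makes <z_k, M_k (x - l)> converge. Its
    limit is both <x, w> and <l, w>, where w is the strong limit of M_k (x - l); hence <x - l, w> =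
    0, and coercivity gives x = l. *)
Lemma variable_metric_Opial (s c cz : R) (M : nat -> H -> H) (z : nat -> H)
    (Z : set H) :
  0 < s -> (forall k, SH_ge s (M k)) -> (forall k x, `|M k x| <= c * `|x|) ->
  (forall x, cvgn (fun k => M k x)) -> (forall k, `|z k| <= cz) ->
  (forall x, Z x -> cvgn (fun k => norm_op (M k) (z k - x))) ->
  (forall (F : set_system nat) x, UltraFilter F -> F --> \oo ->
    (forall y, '<z k, y> @[k --> F] --> '<x, y>) -> Z x) ->
  exists2 l, Z l & weakly_cvg z l.
Proof.
move=> s0 sM Mc Mcv zc Zcv ZF.
have SM k : SH (M k) := (sM k).1.
have M0 k : forall x, 0 <= '<M k x, x> := SH_ge_psd (ltW s0) (sM k).
have [F [FU Foo]] := @ultraFilterLemma _ _ eventually_filter.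
have [l lP] := ultra_weak_cvg FU zc.
have Zl : Z l by exact: (ZF F).
exists l => //; apply: (weakly_cvg_ultra zc) => G x GU Goo xP.
have Zx : Z x by exact: (ZF G).
pose w := limn (fun k => M k (x - l)).
have Mw : (fun k => M k (x - l)) @ \oo --> w := Mcv (x - l).
have cst_cv : cvgn (fun k => '<z k, M k (x - l)>).
  (* Polarisation: the terms <M_k z_k, z_k> of the two squared distances cancel. *)
  have -> : (fun k => '<z k, M k (x - l)>) =
    (fun k => 2^-1 * (norm_op (M k) (z k - l) ^+ 2 - norm_op (M k) (z k - x) ^+ 2
      + '<M k x, x> - '<M k l, l>)).
    apply/funext => k; rewrite !norm_opE // (innerC (z k)).
    rewrite !(SHE (SM k)) !innerE (SHC (z k) x (SM k)) (SHC (z k) l (SM k)).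
    by field.
  apply: is_cvgMr; apply: is_cvgB; last first.
    by apply/cvg_ex; exists '<limn (fun k => M k l), l>; exact: cvg_innerl.
  apply: is_cvgD; last first.
    by apply/cvg_ex; exists '<limn (fun k => M k x), x>; exact: cvg_innerl.
  by apply: is_cvgB; apply: is_cvgM; exact: Zcv.
have lim_along (K : set_system nat) u : ProperFilter K -> K --> \oo ->
    (forall y, '<z k, y> @[k --> K] --> '<u, y>) ->
    '<u, w> = limn (fun k => '<z k, M k (x - l)>).
  move=> PK Koo uP.
  have h1 : '<z k, M k (x - l)> @[k --> K] --> '<u, w>.
    apply: (@cvg_inner_bounded _ _ _ K _ z (fun k => M k (x - l)) w cz) => //.
    exact: cvg_trans (cvg_app _ Koo) Mw.
  have h2 : '<z k, M k (x - l)> @[k --> K] -->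
      limn (fun k => '<z k, M k (x - l)>).
    exact: cvg_trans (cvg_app _ Koo) cst_cv.
  by rewrite -(cvg_lim _ h1) //; exact: cvg_lim.
have xl : '<x - l, w> = 0.
  by rewrite innerDl innerNl (lim_along G x) // (lim_along F l) // subrr.
have : s * `|x - l| ^+ 2 <= '<x - l, w>.
  have h : '<x - l, M k (x - l)> @[k --> \oo] --> '<x - l, w>.
    exact: cvg_innerr.
  apply: (cvgr_to_ge h); apply: nearW => k.
  by rewrite innerC; exact: SH_ge_inner.
rewrite xl pmulr_rle0 // => h; apply/eqP.
by rewrite -subr_eq0 -normr_eq0 -sqrf_eq0 eq_le h sqr_ge0.
Qed.

End VariableMetricOpial.

(** * The perturbed inertial iteration *)

Section Convergence.
Variables (R : realType) (H : hilbertType R).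
Variables (A : H -> set H) (B : H -> H) (gA beta : R).
Hypotheses (gA_ge0 : 0 <= gA) (A_max : maximally_monotone A)
  (A_strong : strongly_monotone gA A) (beta_gt0 : 0 < beta)
  (B_coco : cocoercive beta B).
Variables (sigma c kappa : R) (M : nat -> H -> H) (eta : nat -> R).
Hypotheses (sigma_gt0 : 0 < sigma) (M_sigma : forall k, SH_ge sigma (M k))
  (M_le : forall k x, `|M k x| <= c * `|x|)
  (eta_ge0 : forall k, 0 <= eta k) (eta_cvg : cvgn (series eta))
  (M_decr : forall k, succeq_op (fun x => (1 + eta k) *: M k x) (M k.+1))
  (kappa_gt0 : 0 < kappa)
  (M_kappa : forall k x, ((2 * beta)^-1 + kappa) * `|x| ^+ 2 <= '<M k x, x>).
Variables (zm1 : H) (z zbar : nat -> H) (alpha : nat -> R) (eps : nat -> H).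
Hypotheses
  (zbarE : forall k, zbar k = z k + alpha k *: increment zm1 z k)
  (z_rec : forall k,
    resolvent (M k) A (zbar k - inv_op (M k) (B (zbar k))) (z k.+1 - eps k))
  (alpha_ge0 : forall k, 0 <= alpha k)
  (alpha_cvg : cvgn (series (fun k => alpha k * increment_gauge zm1 z M k)))
  (eps_cvg : cvgn (series (fun k => `|eps k|))).

Let p k := z k.+1 - eps k.
Let a k := M k (zbar k - p k) - B (zbar k).
Let Ap k : A (p k) (a k).
Proof. exact: resolvent_mem (M_sigma k) (z_rec k). Qed.

Let SM k : SH (M k) := (M_sigma k).1.
Let M0 k : forall x, 0 <= '<M k x, x> := SH_ge_psd (ltW sigma_gt0) (M_sigma k).

Lemma increment_gauge_ge k :
  norm_op (M k) (increment zm1 z k) <= increment_gauge zm1 z M k.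
Proof. by rewrite le_max lexx. Qed.

Lemma norm_le_norm_op k x : Num.sqrt sigma * `|x| <= norm_op (M k) x.
Proof.
rewrite -(@ler_pXn2r _ 2) ?nnegrE ?mulr_ge0 ?sqrtr_ge0 //.
by rewrite norm_opE // exprMn sqr_sqrtr ?(ltW sigma_gt0) // SH_ge_inner.
Qed.

Lemma norm_op_le_norm k x : norm_op (M k) x <= Num.sqrt `|c| * `|x|.
Proof.
rewrite -(@ler_pXn2r _ 2) ?nnegrE ?mulr_ge0 ?sqrtr_ge0 //.
rewrite norm_opE // exprMn sqr_sqrtr // norm_op_le //.
by rewrite (le_trans (M_le _ _)) // ler_wpM2r // ler_norm.
Qed.

(** The factor 1 + eta_k on squares would give its square root here; it is weakened to 1 + eta_k,
    which is at least 1. *)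
Lemma norm_opS k x : norm_op (M k.+1) x <= (1 + eta k) * norm_op (M k) x.
Proof.
have e1 : 0 <= 1 + eta k by rewrite addr_ge0.
rewrite -(@ler_pXn2r _ 2) ?nnegrE ?mulr_ge0 ?sqrtr_ge0 //.
rewrite exprMn !norm_opE //; have := M_decr k x; rewrite innerZl => h.
rewrite (le_trans h) // ler_wpM2r // expr2 ler_peMl //.
by rewrite lerDl.
Qed.

(** Inertial displacement plus perturbation, both bounded in the metric [M k], so that one summable
    sequence covers all errors of a step. *)
Let e k := alpha k * norm_op (M k) (increment zm1 z k) +
  Num.sqrt `|c| * `|eps k|.

Let e_ge0 k : 0 <= e k.
Proof. by rewrite addr_ge0 ?mulr_ge0 ?sqrtr_ge0. Qed.

Let e_cvg : cvgn (series e).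
Proof.
apply: (@series_le_cvg _ _ ((fun k => alpha k * increment_gauge zm1 z M k) +
    (Num.sqrt `|c|) *: (fun k => `|eps k|))) => //.
- move=> k; rewrite !fctE addr_ge0 ?mulr_ge0 ?sqrtr_ge0 //.
  exact: le_trans (norm_op_ge0 _ _) (increment_gauge_ge k).
- by move=> k; rewrite !fctE lerD2r ler_wpM2l // increment_gauge_ge.
- by apply: is_cvg_seriesD => //; exact: is_cvg_seriesZ.
Qed.

Let e_cvg0 : e @ \oo --> 0. Proof. exact: cvg_series_cvg_0. Qed.

(** * Estimates relative to a fixed zero *)

Section Zero.
Variable zs : H.
Hypothesis ABzs : A zs (- B zs).

Let n k := norm_op (M k) (z k - zs).

(** [kappa] is split in two: one half stays in front of |zbar - p|^2, the other raises the Young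
    weight above 1 / (2 beta), which makes the last coefficient positive. *)
Let step k : norm_op (M k) (p k - zs) ^+ 2 + kappa / 2 * `|zbar k - p k| ^+ 2 +
  (2 * beta - ((2 * beta)^-1 + kappa / 2)^-1) * `|B (zbar k) - B zs| ^+ 2 <=
  norm_op (M k) (zbar k - zs) ^+ 2.
Proof.
rewrite !norm_opE //; apply: (cocoercive_step A_strong (SM k) ABzs (Ap k)) => //.
  by rewrite addr_gt0 ?invr_gt0 ?mulr_gt0 // divr_gt0.
by move=> x; rewrite -addrA -splitr.
Qed.

Lemma coco_coef_gt0 : 0 < 2 * beta - ((2 * beta)^-1 + kappa / 2)^-1.
Proof.
have b2 : 0 < 2 * beta by rewrite mulr_gt0.
rewrite subr_gt0 -[ltRHS]invrK ltf_pV2 ?posrE ?invr_gt0 //.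
  by rewrite ltrDl divr_gt0.
by rewrite addr_gt0 ?invr_gt0 // divr_gt0.
Qed.

Let zbar_le_increment k : norm_op (M k) (zbar k - zs) <=
  n k + alpha k * norm_op (M k) (increment zm1 z k).
Proof.
rewrite zbarE addrAC (le_trans (norm_opD _ _ (SM k) (M0 k))) //.
by rewrite norm_opZ // ger0_norm.
Qed.

Let zbar_le k : norm_op (M k) (zbar k - zs) <= n k + e k.
Proof.
rewrite (le_trans (zbar_le_increment k)) // /e addrA lerDl.
by rewrite mulr_ge0 ?sqrtr_ge0.
Qed.

Let p_le_zbar k : norm_op (M k) (p k - zs) <= norm_op (M k) (zbar k - zs).
Proof.
rewrite -(@ler_pXn2r _ 2) ?nnegrE ?sqrtr_ge0 //.
apply: le_trans (step k); rewrite -[leRHS]addrA lerDl addr_ge0 // mulr_ge0 //.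
  by rewrite divr_ge0 // ltW.
exact: ltW coco_coef_gt0.
Qed.

Let nS_le k : n k.+1 <= (1 + eta k) * (norm_op (M k) (p k - zs) +
  Num.sqrt `|c| * `|eps k|).
Proof.
rewrite /n (le_trans (norm_opS _ _)) // ler_wpM2l ?addr_ge0 //.
have -> : z k.+1 - zs = (p k - zs) + eps k by rewrite addrAC subrK.
by rewrite (le_trans (norm_opD _ _ (SM k) (M0 k))) // lerD2l norm_op_le_norm.
Qed.

(** The chain n_(k+1) <= (1 + eta_k) (n_k + 2 e_k) is a quasi-monotone recursion; [e k] is counted
    once for the inertia and once for the perturbation. *)
Lemma dist_cvgn : cvgn (fun k => norm_op (M k) (z k - zs)).
Proof.
have e2 k : 0 <= 2 * e k by rewrite mulr_ge0.
apply: (quasi_monotone_cvgn eta_ge0 eta_cvg (e := fun k => 2 * e k)) => //.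
- by move=> k; exact: norm_op_ge0.
- exact: (is_cvg_seriesZ (k := 2) e_cvg).
move=> k; rewrite (le_trans (nS_le k)) // ler_wpM2l ?addr_ge0 //.
have := zbar_le k; have := p_le_zbar k; rewrite /n.
have : Num.sqrt `|c| * `|eps k| <= e k.
  by rewrite lerDr mulr_ge0 ?sqrtr_ge0.
by lra.
Qed.

(** The decrease of the squared distance over one unperturbed step. By [step] it dominates multiples
    of both residuals, |zbar - p|^2 and |B zbar - B zs|^2. *)
Let gap k := norm_op (M k) (zbar k - zs) ^+ 2 - norm_op (M k) (p k - zs) ^+ 2.

Let gap_cvg0 : gap @ \oo --> 0.
Proof.
pose l := limn n; have nl : n @ \oo --> l := dist_cvgn.
have etal0 : eta @ \oo --> 0 by exact: cvg_series_cvg_0.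
(* An upper bound for the distance of [zbar k] minus a lower bound for that of [p k]; both tend to
   l. The gap is this difference of distances times their sum. *)
pose t k := n k + e k - ((1 + eta k)^-1 * n k.+1 - e k).
have t0 : t @ \oo --> 0.
  have -> : 0 = l + 0 - ((1 + 0)^-1 * l - 0) :> R.
    by rewrite !addr0 subr0 invr1 mul1r subrr.
  apply: cvgB; first exact: cvgD.
  apply: cvgB => //; apply: cvgM; last by rewrite (cvg_shiftS n).
  apply: cvgV; first by rewrite addr0 oner_neq0.
  by apply: cvgD => //; exact: cvg_cst.
apply: (squeeze_norm0 (f := gap) (g := fun k => t k * (2 * (n k + e k)))).
  move=> k; have y0 := norm_op_ge0 (M k) (zbar k - zs).
  have p0 := norm_op_ge0 (M k) (p k - zs).
  have py := p_le_zbar k; have yn := zbar_le k.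
  rewrite /gap ger0_norm ?subr_ge0 ?ler_pXn2r ?nnegrE // subr_sqr.
  apply: ler_pM; rewrite ?subr_ge0 ?addr_ge0 //; last by lra.
  rewrite /t; have e1 : 0 < 1 + eta k by rewrite ltr_wpDr.
  have : (1 + eta k)^-1 * n k.+1 - e k <= norm_op (M k) (p k - zs).
    rewrite lerBlDr ler_pdivrMl // (le_trans (nS_le k)) // ler_pM2l //.
    by rewrite lerD2l lerDr mulr_ge0 ?sqrtr_ge0.
  by lra.
rewrite -(mul0r (2 * (l + 0))); apply: cvgM => //; apply: cvgMr.
exact: cvgD.
Qed.

Lemma zbarBp_cvg0 : zbar k - p k @[k --> \oo] --> 0.
Proof.
apply: (squeeze_sqr_norm0 (g := fun k => 2 / kappa * gap k)).
  move=> k; rewrite -ler_pdivrMl ?divr_gt0 // invf_div.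
  have := step k; rewrite /gap.
  have : 0 <= (2 * beta - ((2 * beta)^-1 + kappa / 2)^-1) *
      `|B (zbar k) - B zs| ^+ 2 by rewrite mulr_ge0 ?(ltW coco_coef_gt0).
  by lra.
by rewrite -(mulr0 (2 / kappa)); exact: cvgMr.
Qed.

Lemma Bzbar_cvg : B (zbar k) @[k --> \oo] --> B zs.
Proof.
apply/subr_cvg0.
have d0 := coco_coef_gt0.
set d := 2 * beta - _ in d0.
apply: (squeeze_sqr_norm0 (g := fun k => d^-1 * gap k)).
  move=> k; rewrite ler_pdivlMl //.
  have := step k; rewrite -/d /gap.
  have : 0 <= kappa / 2 * `|zbar k - p k| ^+ 2.
    by rewrite mulr_ge0 // divr_ge0 // ltW.
  by lra.
by rewrite -(mulr0 d^-1); exact: cvgMr.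
Qed.

Let dist_bounded : exists2 cn, 0 <= cn & forall k, n k <= cn.
Proof.
have [cn [_ nP]] := cvg_seq_bounded dist_cvgn.
have {}nP := nP (cn + 1) (ltac:(by rewrite ltrDl)).
exists `|cn + 1| => // k; apply: le_trans (ler_norm _).
by rewrite (le_trans (ler_norm _)) // nP.
Qed.

Lemma iterates_bounded : exists cz, forall k, `|z k| <= cz.
Proof.
have [cn _ nP] := dist_bounded.
have s0 : 0 < Num.sqrt sigma by rewrite sqrtr_gt0.
exists (cn / Num.sqrt sigma + `|zs|) => k.
rewrite -[z k](subrK zs) (le_trans (ler_normD _ _)) // lerD2r.
by rewrite ler_pdivlMr // mulrC (le_trans (norm_le_norm_op k _)) // nP.
Qed.

Lemma momentum_cvg0 : zbar k - z k @[k --> \oo] --> 0.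
Proof.
have s0 : 0 < Num.sqrt sigma by rewrite sqrtr_gt0.
apply: (squeeze_norm0 (g := fun k => (Num.sqrt sigma)^-1 * e k)).
  move=> k; rewrite ler_pdivlMl // (le_trans (norm_le_norm_op k _)) //.
  rewrite zbarE addrAC subrr add0r norm_opZ // ger0_norm // lerDl.
  by rewrite mulr_ge0 ?sqrtr_ge0.
by rewrite -(mulr0 (Num.sqrt sigma)^-1); exact: cvgMr.
Qed.

(** The graph points (p_k, a_k) of [A] converge weakly in the first component, to x, and strongly in
    the second, to - B zs. Co-coercivity identifies B zs with B x, and maximality closes the graph
    under such limits. *)
Lemma ultra_limit_zer (F : set_system nat) (x : H) :
  UltraFilter F -> F --> \oo -> (forall y, '<z k, y> @[k --> F] --> '<x, y>) ->
  A x (- B x).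
Proof.
move=> FU Foo xP; have [cz zc] := iterates_bounded.
have toF (u : nat -> H) (l : H) : u @ \oo --> l -> u @ F --> l.
  exact: cvg_trans (cvg_app _ Foo).
have BF : B (zbar k) @[k --> F] --> B zs by exact/toF/Bzbar_cvg.
(* Used with v = zbar - z and v = p - z: vanishing shifts of z_k keep its weak limit when paired
   with a strongly convergent q. *)
have shift (v q : nat -> H) (q0 l : H) : v k @[k --> F] --> 0 ->
    q k @[k --> F] --> q0 ->
    '<z k + v k - l, q k> @[k --> F] --> '<x - l, q0>.
  move=> v0 qq0.
  have -> : (fun k => '<z k + v k - l, q k>) =
      (fun k => '<z k, q k> + ('<v k, q k - q0> + '<v k, q0> - '<l, q k>)).
    by apply/funext => k; rewrite !innerE; ring.
  rewrite innerDl innerNl; apply: cvgD.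
    exact: (cvg_inner_bounded zc).
  rewrite -[X in _ --> X]add0r; apply: cvgB; last exact: cvg_innerr.
  rewrite -[X in _ --> X]addr0; apply: cvgD; last first.
    by rewrite -(inner0l q0); exact: cvg_innerl.
  apply: (squeeze_norm0 (g := fun k => `|v k| * `|q k - q0|)).
    by move=> k; exact: normr_inner_le.
  rewrite -(mulr0 0); apply: cvgM; apply/norm_cvg0P => //.
  exact/subr_cvg0.
have zbarF := toF _ _ momentum_cvg0.
(* By co-coercivity beta |B zbar - B x|^2 <= <zbar - x, B zbar - B x>, whose limit is <x - x, B zs -
   B x> = 0. *)
have BxE : B zs = B x.
  have q0 : B (zbar k) - B x @[k --> F] --> B zs - B x.
    by apply: cvgB => //; exact: cvg_cst.
  have := shift _ _ _ x zbarF q0; rewrite subrr inner0l => h.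
  have h2 : B (zbar k) - B x @[k --> F] --> 0.
    apply: (squeeze_sqr_norm0 (g := fun k => beta^-1 *
        '<z k + (zbar k - z k) - x, B (zbar k) - B x>)).
      move=> k; rewrite ler_pdivlMl //.
      by rewrite [z k + _]addrC subrK; exact: B_coco.
    by rewrite -(mulr0 beta^-1); exact: cvgMr.
  by apply/eqP; rewrite -subr_eq0; apply/eqP; exact: (cvg_unique _ q0 h2).
apply: maximally_monotone_mem => // v w Avw.
have pF : p k - z k @[k --> F] --> 0.
  have -> : (fun k => p k - z k) = (fun k => (zbar k - z k) - (zbar k - p k)).
    by apply/funext => k; rewrite opprB [RHS]addrC addrA subrK.
  by rewrite -(subrr (0 : H)); apply: cvgB => //; exact/toF/zbarBp_cvg0.
have aF : a k - w @[k --> F] --> - B x - w.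
  apply: cvgB; last exact: cvg_cst.
  rewrite -[- B x]add0r -BxE; apply: cvgB => //; apply: toF.
  apply: (squeeze_norm0 (g := fun k => c * `|zbar k - p k|)).
    by move=> k; exact: M_le.
  by rewrite -(mulr0 c); apply: cvgMr; apply/norm_cvg0P; exact: zbarBp_cvg0.
(* The monotonicity inequality 0 <= <p_k - v, a_k - w> is passed to the limit. *)
apply: (cvgr_to_ge (shift _ _ _ v pF aF)); apply: nearW => k.
rewrite [z k + _]addrC subrK.
by have := A_max.1 _ _ _ _ (Ap k) Avw; rewrite mul0r.
Qed.

(** Since |x|^2 >= <M_k x, x> / C, a positive [gA] enlarges the left side of the step estimate by
    the factor 1 + 2 gA / C, and a positive [gB] shrinks the right side by 1 - gB / C. *)
Lemma step_contraction (gB : R) : 0 <= gB ->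
  strongly_monotone gB (single_valued B) -> 0 < gA \/ 0 < gB ->
  (forall k x, beta^-1 * `|x| ^+ 2 <= '<M k x, x>) ->
  exists2 q : R, 0 < q < 1 & forall k,
    norm_op (M k) (p k - zs) ^+ 2 <= q * norm_op (M k) (zbar k - zs) ^+ 2.
Proof.
(* The summand gB + 1 ensures C > gB, hence 1 - gB / C > 0. *)
move=> gB0 Bs gAB Mb; pose C := `|c| + gB + 1.
have C0 : 0 < C by rewrite ltr_wpDl ?addr_ge0.
have MC k x : '<M k x, x> / C <= `|x| ^+ 2.
  rewrite ler_pdivrMr // mulrC; apply: norm_op_le; first exact: ltW.
  rewrite (le_trans (M_le k x)) // ler_wpM2r // (le_trans (ler_norm c)) //.
  by rewrite /C -addrA lerDl addr_ge0.
have st k := strongly_monotone_step A_strong (SM k) ABzs (Ap k) beta_gt0 B_coco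
  Bs (Mb k).
case: gAB => [gA0|gB0'].
- pose t := 2 * gA / C; have t0 : 0 < t by rewrite divr_gt0 ?mulr_gt0.
  exists (1 + t)^-1.
    by rewrite invr_gt0 addr_gt0 //= invf_lt1 ?addr_gt0 // ltrDl.
  move=> k; rewrite !norm_opE // ler_pdivlMl ?addr_gt0 //.
  apply: le_trans (st k).
  have : 0 <= gB * `|zbar k - zs| ^+ 2 by rewrite mulr_ge0.
  have : 2 * gA * ('<M k (p k - zs), p k - zs> / C) <= 2 * gA * `|p k - zs| ^+ 2.
    by rewrite ler_pM2l ?mulr_gt0.
  have -> : 2 * gA * ('<M k (p k - zs), p k - zs> / C) =
      t * '<M k (p k - zs), p k - zs> by rewrite /t; ring.
  by lra.
- exists (1 - gB / C).
    rewrite subr_gt0 ltr_pdivrMr // mul1r gtrBl divr_gt0 // andbT.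
    by rewrite /C; have := normr_ge0 c; lra.
  move=> k; rewrite !norm_opE //; have := st k.
  have : 0 <= 2 * gA * `|p k - zs| ^+ 2 by rewrite !mulr_ge0.
  have : gB * ('<M k (zbar k - zs), zbar k - zs> / C) <= gB * `|zbar k - zs| ^+ 2.
    by rewrite ler_pM2l.
  have -> : gB * ('<M k (zbar k - zs), zbar k - zs> / C) =
      gB / C * '<M k (zbar k - zs), zbar k - zs> by ring.
  by lra.
Qed.

Lemma linear_rate (q Lambda : R) : 0 < q < 1 -> (forall k, alpha k <= Lambda) ->
  (forall k, eps k = 0) ->
  (forall k, norm_op (M k) (p k - zs) ^+ 2 <=
    q * norm_op (M k) (zbar k - zs) ^+ 2) ->
  exists (xi Theta : R) (K0 : nat), [/\ 0 < xi < 1, 0 < Theta &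
    forall k, (K0 <= k)%N -> n k ^+ 2 <= (1 - xi) ^+ (k - K0)%N * n K0 ^+ 2 +
      \sum_(K0 <= i < k) Theta * (1 - xi) ^+ (k - i)%N * alpha i *
        increment_gauge zm1 z M i].
Proof.
move=> /andP[q0 q1] alphaL eps0 qP.
have [cn cn0 nP] := dist_bounded.
have etal0 : eta @ \oo --> 0 by exact: cvg_series_cvg_0.
(* The rate is the midpoint of q and 1: once eta_k < (1 - q) / 2, the product (1 + eta_k) q is at
   most 1 - (1 - q) / 2. *)
have xi0 : 0 < (1 - q) / 2 by rewrite divr_gt0 ?subr_gt0.
move/cvgr0Pnorm_lt : etal0 => /(_ _ xi0) [K0 _ etaK].
have L0 : 0 <= Lambda by exact: le_trans (alphaL 0%N).
(* In (n_k + alpha_k d)^2 the cross term is at most 2 cn alpha_k g and the square at most Lambda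
   alpha_k g, as d and d^2 are both at most the gauge g. The 1 makes [Theta] positive. *)
pose Theta := 2 * cn + Lambda + 1.
exists ((1 - q) / 2), Theta, K0; split.
- by rewrite xi0 /=; lra.
- by rewrite /Theta; lra.
have r0 : 0 <= 1 - (1 - q) / 2 by lra.
move=> k Kk; under eq_bigr do rewrite mulrAC (mulrC Theta) -!mulrA.
apply: (geometric_recursion_le (a := fun k => n k ^+ 2)
  (u := fun k => _ )) => // {Kk}k Kk.
set al := alpha k; set g := increment_gauge zm1 z M k.
pose d := norm_op (M k) (increment zm1 z k).
have d0 : 0 <= d by exact: norm_op_ge0.
have dg : d <= g by exact: increment_gauge_ge.
have ddg : d ^+ 2 <= g by rewrite le_max lexx orbT.
have n0 : 0 <= n k by exact: norm_op_ge0.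
have al0 : 0 <= al by exact: alpha_ge0.
have alL : al <= Lambda by exact: alphaL.
have inertia : (n k + al * d) ^+ 2 <= n k ^+ 2 + Theta * (g * al).
  have h1 : n k * (al * d) <= cn * (al * g).
    by apply: ler_pM; rewrite ?mulr_ge0 // ler_wpM2l.
  have h2 : al * (al * d ^+ 2) <= Lambda * (al * g).
    by apply: ler_pM; rewrite ?mulr_ge0 ?sqr_ge0 // ler_wpM2l.
  have h3 : 0 <= al * g by rewrite mulr_ge0 // (le_trans d0).
  by rewrite /Theta; lra.
have zbar2 : norm_op (M k) (zbar k - zs) ^+ 2 <= (n k + al * d) ^+ 2.
  have nd0 : 0 <= n k + al * d by rewrite addr_ge0 ?mulr_ge0.
  by rewrite ler_pXn2r ?nnegrE ?norm_op_ge0 //; exact: zbar_le_increment.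
(* Without perturbation p_k = z_(k+1), and comparing squares directly costs 1 + eta_k only once. *)
have next : n k.+1 ^+ 2 <= (1 + eta k) * norm_op (M k) (p k - zs) ^+ 2.
  rewrite /n /p eps0 subr0 !norm_opE //.
  by have := M_decr k (z k.+1 - zs); rewrite innerZl.
have rate : (1 + eta k) * q <= 1 - (1 - q) / 2.
  have etak : eta k < (1 - q) / 2.
    by rewrite (le_lt_trans (ler_norm _)) // etaK.
  have : eta k * q <= eta k by rewrite ler_piMr // ltW.
  by lra.
have e1 : 0 <= 1 + eta k by rewrite addr_ge0.
rewrite (le_trans next) // (le_trans (ler_wpM2l e1 (qP k))) //.
rewrite [leLHS]mulrA.
apply: (le_trans (ler_wpM2r (sqr_ge0 _) rate)).
by rewrite ler_wpM2l // (le_trans zbar2).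
Qed.

End Zero.

Lemma inertial_forward_backward_weakly_cvg : (exists zs, A zs (- B zs)) ->
  exists2 zs, A zs (- B zs) & weakly_cvg z zs.
Proof.
move=> [z0 Az0]; have [cz zc] := iterates_bounded Az0.
apply: (@variable_metric_Opial _ _ sigma c cz M z) => //.
- exact: (@variable_metric_cvgn _ _ M eta c).
- exact: dist_cvgn.
- exact: ultra_limit_zer Az0.
Qed.

End Convergence.

(** * Uniform bounds from the hypotheses, and assembly of the theorem *)

Lemma op_norm_bounded (R : realType) (H : hilbertType R) (M : nat -> H -> H) :
  (forall k, SH (M k)) ->
  (ereal_sup (range (fun k => (op_norm (M k))%:E)) < +oo)%E ->
  exists c : R, forall k x, `|M k x| <= c * `|x|.
Proof.
move=> SM; set S := ereal_sup _ => Soo.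
have Sge k : ((op_norm (M k))%:E <= S)%E by apply: ereal_sup_ubound; exists k.
have {Soo Sge} [c cP] : exists c : R, forall k, op_norm (M k) <= c.
  (* The value -oo is excluded by the member of index 0. *)
  case: S Soo Sge => [c _ Sc|//|_ /(_ 0%N) //].
  by exists c => k; rewrite -lee_fin.
by exists c => k x; rewrite (le_trans (op_norm_ge x (SM k))) // ler_wpM2r.
Qed.

Lemma SH_ge_shift (R : realType) (H : hilbertType R) (M : H -> H) (a b : R) :
  SH_ge b (fun x => M x - a *: x) ->
  forall x, (a + b) * `|x| ^+ 2 <= '<M x, x>.
Proof.
move=> /SH_ge_inner + x => /(_ x).
by rewrite innerDl innerNl innerZl inner_sqr mulrDl; lra.
Qed.

Theorem theorem3p1 (R : realType) (H : hilbertType R)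
  (A : H -> set H) (B : H -> H) (gA gB beta : R)
  (gA_ge0 : 0 <= gA) (A_max : maximally_monotone A)
  (A_strong : strongly_monotone gA A)
  (beta_gt0 : 0 < beta) (B_coco : cocoercive beta B)
  (gB_ge0 : 0 <= gB) (B_strong : strongly_monotone gB (single_valued B))
  (zer_neq0 : zer (add_op A (single_valued B)) !=set0)
  (sigma : R) (sigma_gt0 : 0 < sigma)
  (M : nat -> H -> H) (M_sigma : forall k, SH_ge sigma (M k))
  (M_bounded : (ereal_sup (range (fun k => (op_norm (M k))%:E)) < +oo)%E)
  (M_decr : exists eta : nat -> R,
    [/\ forall k, 0 <= eta k,
        (\sum_(0 <= k <oo) (eta k)%:E < +oo)%E &
        forall k, succeq_op (fun x => (1 + eta k) *: M k x) (M k.+1)])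
  (M_kappa : exists2 kappa : R, 0 < kappa &
    forall k, SH_ge kappa (fun x => M k x - (2 * beta)^-1 *: x))
  (zm1 : H) (z zbar : nat -> H) (alpha : nat -> R) (eps : nat -> H)
  (zbarE : forall k, zbar k = z k + alpha k *: increment zm1 z k)
  (z_rec : forall k,
    resolvent (M k) A (zbar k - inv_op (M k) (B (zbar k))) (z k.+1 - eps k))
  (alpha_bounded : exists Lambda : R, forall k, 0 < alpha k <= Lambda)
  (alpha_summable :
    (\sum_(0 <= k <oo) (alpha k * increment_gauge zm1 z M k)%:E < +oo)%E)
  (eps_summable : (\sum_(0 <= k <oo) (`|eps k|)%:E < +oo)%E) :
  bounded_fun z /\
  exists zs : H,
    [/\ zer (add_op A (single_valued B)) zs,
        weakly_cvg z zs &
        (forall k, eps k = 0) ->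
        0 < gA \/ 0 < gB ->
        (exists2 kappa : R, 0 < kappa &
          forall k, SH_ge kappa (fun x => M k x - beta^-1 *: x)) ->
        exists (xi Theta : R) (K0 : nat),
          [/\ 0 < xi < 1, 0 < Theta &
            forall k, (K0 < k)%N ->
              norm_op (M k) (z k - zs) ^+ 2 <=
                (1 - xi) ^+ (k - K0)%N * norm_op (M K0) (z K0 - zs) ^+ 2 +
                \sum_(K0 <= i < k)
                  Theta * (1 - xi) ^+ (k - i)%N * alpha i *
                  increment_gauge zm1 z M i]].
Proof.
have [eta [eta0 eta_sum M_eta]] := M_decr.
have eta_cvg := nnseries_is_cvg eta0 eta_sum.
have [kappa kappa0 Mk] := M_kappa.
have [Lambda alphaL] := alpha_bounded.
have alpha0 k : 0 <= alpha k by have /andP[/ltW] := alphaL k.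
have SM k : SH (M k) := (M_sigma k).1.
have [c Mc] := op_norm_bounded SM M_bounded.
have gauge0 k : 0 <= increment_gauge zm1 z M k.
  by rewrite le_max norm_op_ge0.
have alpha_cvg : cvgn (series (fun k => alpha k * increment_gauge zm1 z M k)).
  by apply: nnseries_is_cvg => // k; rewrite mulr_ge0.
have eps_cvg : cvgn (series (fun k => `|eps k|)) by exact: nnseries_is_cvg.
have Mk' k := SH_ge_shift (Mk k).
have Azer : exists zs, A zs (- B zs).
  by have [zs /zer_addP] := zer_neq0; exists zs.
have [zs Azs zs_lim] := inertial_forward_backward_weakly_cvg gA_ge0 A_max
  A_strong beta_gt0 B_coco sigma_gt0 M_sigma Mc eta0 eta_cvg M_eta kappa0 Mk'
  zbarE z_rec alpha0 alpha_cvg eps_cvg Azer.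
split.
  have [cz zc] := iterates_bounded gA_ge0 A_strong beta_gt0 B_coco sigma_gt0
    M_sigma Mc eta0 eta_cvg M_eta kappa0 Mk' zbarE z_rec alpha0 alpha_cvg
    eps_cvg Azs.
  (* [bounded_fun] asks that every real above some threshold be a bound. *)
  exists cz; split; first exact: num_real.
  by move=> r czr k _; rewrite /= (le_trans (zc k)) // ltW.
exists zs; split => //; first exact/zer_addP.
move=> eps0 gAB [kappa' kappa'0 Mk2].
have Mb k x : beta^-1 * `|x| ^+ 2 <= '<M k x, x>.
  rewrite (le_trans _ (SH_ge_shift (Mk2 k) x)) // mulrDl lerDl.
  by rewrite mulr_ge0 ?(ltW kappa'0).
have [q q01 qP] := step_contraction gA_ge0 A_strong beta_gt0 B_coco sigma_gt0
  M_sigma Mc z_rec Azs gB_ge0 B_strong gAB Mb.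
have alphaL' k : alpha k <= Lambda by have /andP[] := alphaL k.
have [xi [th [K0 [xi01 th0 rate]]]] := linear_rate gA_ge0 A_strong
  beta_gt0 B_coco sigma_gt0 M_sigma Mc eta0 eta_cvg M_eta kappa0 Mk' zbarE
  z_rec alpha0 alpha_cvg eps_cvg Azs q01 alphaL' eps0 qP.
by exists xi, th, K0; split => // k /ltnW /rate.
Qed.
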